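(* Let $\mathcal{A}=\mathcal{A}_1\cup\mathcal{A}_2\cup\mathcal{A}_3$ be an arrangement of $12$ lines in $\mathbb{P}^2\mathbb{C}$ defined by a $(3,4)$-net, with all intersection points double or triple points. Suppose the Latin square of the net is in the main class of $M_1$ or in the main class of $M_2$, where $$M_1=\begin{pmatrix}1&2&3&4\\2&3&4&1\\3&4&1&2\\4&1&2&3\end{pmatrix},\qquad M_2=\begin{pmatrix}1&2&3&4\\2&1&4&3\\3&4&1&2\\4&3&2&1\end{pmatrix}.$$ Then, for either main class, exactly one of the following holds. (1) All three $\mathcal{A}_i$ are of type (ii), and $\mathcal{A}$ has $16$ triple points. (2) All three $\mathcal{A}_i$ are of type (i), and $\mathcal{A}$ has $19$ triple points. (3) Exactly one $\mathcal{A}_i$ is of type (i) and the other two are of type (ii), and $\mathcal{A}$ has $17$ triple points. In particular, it never happens that exactly two of the $\mathcal{A}_i$ are of type (i). Moreover, for each fixed main class ($M_1$ or $M_2$), each of the three situations occurs. Within a given situation, any two such arrangements are lattice isomorphic. Hence the number of triple points determines $\mathcal{A}$ up to lattice isomorphism.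
   Context: A $(3,q)$-net in $\mathbb{P}^2\mathbb{C}$ is a line arrangement $\mathcal{A}$ together with a partition $\mathcal{A}=\mathcal{A}_1\sqcup\mathcal{A}_2\sqcup\mathcal{A}_3$ with $|\mathcal{A}_i|=q$ for each $i$, such that every intersection point of two lines from different classes lies on exactly one line of each class. A mixed triple point is a point lying on one line from each class; there are $q^2$ of them. The Latin square of the net is obtained as follows. Order the lines $\mathcal{A}_j=\{L^j_1,\dots,L^j_q\}$. Then the $(k,l)$ entry is the index $\alpha(k,l)$ such that $L^1_k\cap L^2_l\cap L^3_{\alpha(k,l)}\neq\emptyset$. Two Latin squares are in the same main class if one is obtained from the other by permuting rows, permuting columns, permuting symbols, and permuting the roles of rows, columns and symbols among themselves. For $q=4$ there are exactly two main classes, represented by $M_1$ and $M_2$. A class $\mathcal{A}_j$ is of type (i) if three of its lines meet at a point, and of type (ii) otherwise, in which case all intersections inside $\mathcal{A}_j$ are double points. A point is double or triple if exactly $2$ or $3$ lines of $\mathcal{A}$ pass through it. Two line arrangements are lattice isomorphic if there is a bijection between their lines preserving which subsets of lines are concurrent. *)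

(* Defs.v *)
From HB Require Import structures.
From mathcomp Require Import all_boot all_order all_algebra all_fingroup.
Set Implicit Arguments. Unset Strict Implicit. Unset Printing Implicit Defensive.
Import Order.TTheory GRing.Theory Num.Theory.
Local Open Scope ring_scope.

(* Index type of the 12 lines of a (3,4)-net: (class j, index a),
   class j : 'I_3 stands for A_(j+1), a : 'I_4 for L^(j+1)_(a+1). *)
Notation netI := ('I_3 * 'I_4)%type.

(* Points and lines of P^2 over C are nonzero row vectors of C^3 (up to
   nonzero scalars); incidence is vanishing of the bilinear pairing. *)
Definition incid (C : numClosedFieldType) (p l : 'rV[C]_3) : bool :=
  \sum_(i < 3) p 0 i * l 0 i == 0.

Definition is_arrangement (C : numClosedFieldType) (L : netI -> 'rV[C]_3) : Prop :=
  (forall x, L x != 0) /\ (forall x y, x != y -> forall c : C, L x != c *: L y).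

Definition lines_through (C : numClosedFieldType) (L : netI -> 'rV[C]_3)
  (p : 'rV[C]_3) : {set netI} := [set x | incid p (L x)].

Definition concurrent (C : numClosedFieldType) (L : netI -> 'rV[C]_3)
  (S : {set netI}) : Prop :=
  exists p : 'rV[C]_3, p != 0 /\ forall x, x \in S -> incid p (L x).

Definition is_net (C : numClosedFieldType) (L : netI -> 'rV[C]_3) : Prop :=
  forall x y : netI, x.1 != y.1 ->
  forall p : 'rV[C]_3, p != 0 -> incid p (L x) -> incid p (L y) ->
  forall k : 'I_3, #|[set a : 'I_4 | incid p (L (k, a))]| = 1%N.

Definition double_or_triple (C : numClosedFieldType) (L : netI -> 'rV[C]_3) : Prop :=
  forall p : 'rV[C]_3, p != 0 -> (2 <= #|lines_through L p|)%N ->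
  (#|lines_through L p| <= 3)%N.

(* Class j is of type (i): three of its lines meet at a point.
   Type (ii) is the negation. *)
Definition type_i (C : numClosedFieldType) (L : netI -> 'rV[C]_3) (j : 'I_3) : Prop :=
  exists S : {set 'I_4}, #|S| = 3%N /\ concurrent L [set (j, a) | a in S].

(* A has exactly n triple points.  A triple point is identified with the
   set of (exactly 3) lines through it (distinct points have distinct
   such sets, two distinct lines meeting in a single point). *)
Definition num_triple_points (C : numClosedFieldType) (L : netI -> 'rV[C]_3)
  (n : nat) : Prop :=
  exists T : {set {set netI}}, #|T| = n /\
    forall S : {set netI},
      S \in T <-> (#|S| = 3%N /\ exists p : 'rV[C]_3, p != 0 /\ lines_through L p = S).

(* Latin squares given as lists of rows with symbols 1..4 as in the paper;
   entry (k,l) (0-based) shifted to a symbol in 0..3. *)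
Definition M1 : seq (seq nat) :=
  [:: [:: 1; 2; 3; 4]; [:: 2; 3; 4; 1]; [:: 3; 4; 1; 2]; [:: 4; 1; 2; 3]]%N.
Definition M2 : seq (seq nat) :=
  [:: [:: 1; 2; 3; 4]; [:: 2; 1; 4; 3]; [:: 3; 4; 1; 2]; [:: 4; 3; 2; 1]]%N.

Definition ls_entry (M : seq (seq nat)) (k l : nat) : nat :=
  (nth 0 (nth [::] M k) l).-1.

Definition ls_triple (M : seq (seq nat)) (t : 'I_3 -> 'I_4) : Prop :=
  nat_of_ord (t 2%R) = ls_entry M (t 0%R) (t 1%R).

(* Triples of the Latin square of the net: (k,l,m) with
   L^1_k, L^2_l, L^3_m concurrent, i.e. alpha(k,l) = m. *)
Definition net_triple (C : numClosedFieldType) (L : netI -> 'rV[C]_3)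
  (t : 'I_3 -> 'I_4) : Prop :=
  concurrent L [set ((0%R : 'I_3), t 0%R); ((1%R : 'I_3), t 1%R); ((2%R : 'I_3), t 2%R)].

(* The Latin square of the net is in the main class of M: obtained from M
   by permuting rows, columns, symbols (sigma) and the roles of rows,
   columns, symbols (tau). *)
Definition in_main_class (C : numClosedFieldType) (L : netI -> 'rV[C]_3)
  (M : seq (seq nat)) : Prop :=
  exists (tau : {perm 'I_3}) (sigma : 'I_3 -> {perm 'I_4}),
    forall t : 'I_3 -> 'I_4,
      net_triple L t <-> ls_triple M (fun i => sigma i (t (tau i))).

Definition good_net (C : numClosedFieldType) (L : netI -> 'rV[C]_3)
  (M : seq (seq nat)) : Prop :=
  [/\ is_arrangement L, is_net L, double_or_triple L & in_main_class L M].

Definition situation1 (C : numClosedFieldType) (L : netI -> 'rV[C]_3) : Prop :=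
  forall j, ~ type_i L j.
Definition situation2 (C : numClosedFieldType) (L : netI -> 'rV[C]_3) : Prop :=
  forall j, type_i L j.
Definition situation3 (C : numClosedFieldType) (L : netI -> 'rV[C]_3) : Prop :=
  exists j, type_i L j /\ forall j', j' != j -> ~ type_i L j'.

Definition situation (C : numClosedFieldType) (L : netI -> 'rV[C]_3)
  (s : 'I_3) : Prop :=
  match nat_of_ord s with
  | 0%N => situation1 L | 1%N => situation2 L | _ => situation3 L
  end.

Definition lattice_iso (C : numClosedFieldType) (L L' : netI -> 'rV[C]_3) : Prop :=
  exists f : {perm netI},
    forall S : {set netI}, concurrent L S <-> concurrent L' (f @: S).

(* Main.v *)
From Stdlib Require Import BinInt.
Require Import Defs.
From HB Require Import structures.
From mathcomp Require Import all_boot all_order all_algebra all_fingroup.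
From mathcomp Require Import ssrZ ring.
Set Implicit Arguments. Unset Strict Implicit. Unset Printing Implicit Defensive.
Import Order.TTheory GRing.Theory Num.Theory.
Local Open Scope ring_scope.

(* Both Latin squares are multiplication tables of groups G of order 4, so the
   lines of each class can be labelled by G in such a way that lines labelled
   x, y, z, one from each class, are concurrent iff x + y + z = 0.  A class of
   type (i) has exactly one concurrent triple; call the label of the remaining
   line its mark.  If two classes are of type (i) with marks a and b, their two
   pencils of three lines form a dual Pappus configuration, and Pappus' theorem
   says that the third class is of type (i) too, with mark c determined by
   a + b + c = sum of all elements of G.  Hence 0, 1 or 3 classes are of type
   (i), and there are 16 + 0, 1 or 3 triple points.  Translations of the labels
   by (u, v, w) with u + v + w = 0 and permutations of the classes respect the
   net, and they act transitively on the possible marks in each situation. *)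

(** * Points and lines *)

Section ProjectivePlane.
Variable C : numClosedFieldType.
Implicit Types u v w p q : 'rV[C]_3.

Lemma ord3_ind (P : 'I_3 -> Prop) : P 0 -> P 1 -> P 2%:R -> forall i, P i.
Proof.
move=> P0 P1 P2 [[|[|[|//]]] lt_i];
  [have -> : Ordinal lt_i = 0 | have -> : Ordinal lt_i = 1
  | have -> : Ordinal lt_i = 2%:R] => //; exact: val_inj.
Qed.

Lemma big_ord3 (V : nmodType) (F : 'I_3 -> V) :
  \sum_i F i = F 0 + F 1 + F 2%:R.
Proof.
rewrite !big_ord_recr big_ord0 /= add0r.
by congr (F _ + F _ + F _); apply: val_inj.
Qed.

Definition dot u v : C := u 0 0 * v 0 0 + u 0 1 * v 0 1 + u 0 2%:R * v 0 2%:R.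

(** Addition on ['I_3] is cyclic, so one formula covers the three coordinates. *)
Definition cross u v : 'rV[C]_3 :=
  \row_i (u 0 (i + 1) * v 0 (i + 2%:R) - u 0 (i + 2%:R) * v 0 (i + 1)).

Definition det3 u v w : C := dot (cross u v) w.

Lemma incidE p u : incid p u = (dot p u == 0).
Proof. by rewrite /incid big_ord3. Qed.

Lemma cross0 u v : (cross u v) 0 0 = u 0 1 * v 0 2%:R - u 0 2%:R * v 0 1.
Proof. by rewrite mxE !add0r. Qed.

Lemma cross1 u v : (cross u v) 0 1 = u 0 2%:R * v 0 0 - u 0 0 * v 0 2%:R.
Proof.
rewrite mxE; have -> : (1 + 1 : 'I_3) = 2%:R by apply: val_inj.
by have -> : (1 + 2%:R : 'I_3) = 0 by apply: val_inj.
Qed.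

Lemma cross2 u v : (cross u v) 0 2%:R = u 0 0 * v 0 1 - u 0 1 * v 0 0.
Proof.
rewrite mxE; have -> : (2%:R + 1 : 'I_3) = 0 by apply: val_inj.
by have -> : (2%:R + 2%:R : 'I_3) = 1 by apply: val_inj.
Qed.

Definition crossE := (cross0, cross1, cross2).

Lemma rV3P u v :
  u 0 0 = v 0 0 -> u 0 1 = v 0 1 -> u 0 2%:R = v 0 2%:R -> u = v.
Proof. by move=> e0 e1 e2; apply/rowP; apply: ord3_ind. Qed.

Lemma cross_crossE u v p :
  cross (cross u v) p = dot u p *: v - dot v p *: u.
Proof. by apply: rV3P; rewrite crossE !crossE !mxE /dot; ring. Qed.

Lemma cross_eq0 u v : u != 0 -> cross u v = 0 -> exists c, v = c *: u.
Proof.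
move=> nz_u uv0; have [i ui] : exists i, u 0 i != 0.
  apply/existsP; apply: contraNT nz_u; rewrite negb_exists => /forallP u0.
  by apply/eqP/rowP => i; rewrite mxE; apply/eqP; rewrite -[_ == _]negbK u0.
exists (v 0 i / u 0 i).
have e0 := cross0 u v; have e1 := cross1 u v; have e2 := cross2 u v.
move: e0 e1 e2; rewrite uv0 !mxE.
move=> /esym/subr0_eq e0 /esym/subr0_eq e1 /esym/subr0_eq e2.
have h j : v 0 j * u 0 i = v 0 i * u 0 j.
  by move: i j {ui}; do 2!apply: ord3_ind; first [ring | ring: e0 | ring: e1 | ring: e2].
by apply/rowP=> j; rewrite mxE mulrAC -h mulfK.
Qed.

Lemma incid_crossl u v : incid (cross u v) u.
Proof. by rewrite incidE; apply/eqP; rewrite /dot !crossE; ring. Qed.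

Lemma incid_crossr u v : incid (cross u v) v.
Proof. by rewrite incidE; apply/eqP; rewrite /dot !crossE; ring. Qed.

Lemma dotC u v : dot u v = dot v u.
Proof. by rewrite /dot; ring. Qed.

Lemma dotZ c u v : dot (c *: u) v = c * dot u v.
Proof. by rewrite /dot !mxE; ring. Qed.

Lemma incid_scale c p u : c != 0 -> incid (c *: p) u = incid p u.
Proof. by move=> nz_c; rewrite !incidE dotZ mulf_eq0 (negPf nz_c). Qed.

(** The triple product expansion [cross_crossE] gives a vanishing cross product of [cross u v] with
    [p], so the two are proportional. *)
Lemma incid_both p u v : cross u v != 0 ->
  incid p u -> incid p v -> exists c, p = c *: cross u v.
Proof.
move=> nz; rewrite !incidE => /eqP pu /eqP pv; apply: cross_eq0 => //.
by rewrite cross_crossE dotC pu dotC pv !scale0r subrr.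
Qed.

Lemma incid_meet p u v w : p != 0 -> cross u v != 0 ->
  incid p u -> incid p v -> incid p w = (det3 u v w == 0).
Proof.
move=> nz_p nz pu pv; have [c pE] := incid_both nz pu pv.
rewrite pE incid_scale -?incidE //.
by apply: contraNneq nz_p; rewrite pE => ->; rewrite scale0r.
Qed.

Lemma det3C u v w : det3 u v w = det3 v w u.
Proof. by rewrite /det3 /dot !crossE; ring. Qed.

Lemma det3A u v w : det3 u w v = - det3 u v w.
Proof. by rewrite /det3 /dot !crossE; ring. Qed.

(** Both [u] and [v] are orthogonal to [cross u w], so [cross u w] is a multiple [c] of [cross u v].
    Then [w - c *: v] has zero cross product with [u]. *)
Lemma det3_dep u v w : cross u v != 0 -> det3 u v w = 0 ->
  exists a b, w = a *: u + b *: v.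
Proof.
move=> nz uvw0; have [||c cE] := @incid_both (cross u w) u v nz.
- exact: incid_crossl.
- by rewrite incidE -/(det3 u w v) det3A uvw0 oppr0.
have nz_u : u != 0.
  by apply: contraNneq nz => ->; apply/eqP/rowP => i; rewrite !mxE !mul0r subrr.
have [|a aE] := @cross_eq0 u (w - c *: v) nz_u.
  move/rowP: cE => cE; apply/rowP => i; move: (cE i); rewrite !mxE.
  by move=> h; rewrite !(mulrDr, mulrN) opprD addrACA h; ring.
by exists a, c; rewrite -aE subrK.
Qed.

(* Reduces Pappus to a polynomial identity in the four brackets of p1, p2, q1, q2. *)
Lemma det3_comb4 (a b c d : 'I_3 -> C) u v w q :
  let r i := a i *: u + b i *: v + c i *: w + d i *: q in
  let m (x y z : 'I_3 -> C) :=
    x 0 * (y 1 * z 2%:R - y 2%:R * z 1) - x 1 * (y 0 * z 2%:R - y 2%:R * z 0)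
    + x 2%:R * (y 0 * z 1 - y 1 * z 0) in
  det3 (r 0) (r 1) (r 2%:R) =
    m a b c * det3 u v w + m a b d * det3 u v q
    + m a c d * det3 u w q + m b c d * det3 v w q.
Proof. by rewrite /= /det3 /dot !crossE !mxE; ring. Qed.

(** The intersection of the lines xy and zt is the cross product of [cross x y] and [cross z t];
    [cross_crossE] expands it in terms of [x] and [y]. *)
Lemma joinE x y z t r : cross (cross x y) (cross z t) != 0 ->
  det3 x y r = 0 -> det3 z t r = 0 ->
  exists k, r = k *: (det3 z t x *: y - det3 z t y *: x).
Proof.
move=> nz xyr ztr; have [||k ->] := @incid_both r _ _ nz.
- by rewrite incidE dotC -/(det3 _ _ _) xyr.
- by rewrite incidE dotC -/(det3 _ _ _) ztr.
by exists k; rewrite cross_crossE ![dot _ (cross _ _)]dotC.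
Qed.

(** All nine vectors are written as combinations of [p1], [p2], [q1], [q2], with coefficients
    polynomial in the brackets of these four. The determinant of the [r]'s then vanishes
    identically. The vectors may be read as points or, dually, as lines. *)
Lemma pappus p1 p2 p3 q1 q2 q3 r1 r2 r3 :
  cross p1 p2 != 0 -> det3 p1 p2 p3 = 0 ->
  cross q1 q2 != 0 -> det3 q1 q2 q3 = 0 ->
  cross (cross p2 q3) (cross p3 q2) != 0 -> det3 p2 q3 r1 = 0 -> det3 p3 q2 r1 = 0 ->
  cross (cross p1 q3) (cross p3 q1) != 0 -> det3 p1 q3 r2 = 0 -> det3 p3 q1 r2 = 0 ->
  cross (cross p1 q2) (cross p2 q1) != 0 -> det3 p1 q2 r3 = 0 -> det3 p2 q1 r3 = 0 ->
  det3 r1 r2 r3 = 0.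
Proof.
move=> nzp p0 nzq q0 nz1 r11 r12 nz2 r21 r22 nz3 r31 r32.
have [a [b p3E]] := det3_dep nzp p0; have [c [d q3E]] := det3_dep nzq q0.
have [k1 r1E] := joinE nz1 r11 r12.
have [k2 r2E] := joinE nz2 r21 r22.
have [k3 r3E] := joinE nz3 r31 r32.
have det3DZ1 x y z t e f : det3 (e *: x + f *: y) z t = e * det3 x z t + f * det3 y z t.
  by rewrite /det3 /dot !crossE !mxE; ring.
have det3DZ3 x y z t e f : det3 z t (e *: x + f *: y) = e * det3 z t x + f * det3 z t y.
  by rewrite /det3 /dot !crossE !mxE; ring.
have det3ii x y : det3 x y x = 0 by rewrite /det3 /dot !crossE; ring.
have det3jj x y : det3 x y y = 0 by rewrite /det3 /dot !crossE; ring.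
set A := det3 p1 p2 q1; set B := det3 p1 p2 q2.
set G := det3 p1 q1 q2; set D := det3 p2 q1 q2.
have eA : det3 p2 q1 p1 = A by rewrite det3C det3C.
have eB : det3 p1 q2 p2 = - B by rewrite det3A.
have eG : det3 p1 q2 q1 = - G by rewrite det3A.
have eD : det3 p2 q2 q1 = - D by rewrite det3A.
(* [E] is the bracket of [p3], [q1], [q2], as [p3 = a *: p1 + b *: p2]. *)
pose E := a * G + b * D.
have {}r1E : r1 = 0 *: p1 + (k1 * c * E) *: p2 + (- k1 * a * B * c) *: q1
                + (- k1 * a * B * d) *: q2.
  rewrite r1E p3E q3E !(det3DZ1, det3DZ3) !(det3ii, det3jj) eB eG eD /E.
  by apply/rowP => i; rewrite !mxE; ring.
have {}r2E : r2 = (- k2 * d * E) *: p1 + 0 *: p2 + (k2 * b * A * c) *: q1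
                + (k2 * b * A * d) *: q2.
  rewrite r2E p3E q3E !(det3DZ1, det3DZ3) !(det3ii, det3jj) eA -/G -/D /E.
  by apply/rowP => i; rewrite !mxE; ring.
have {}r3E : r3 = (- k3 * D) *: p1 + 0 *: p2 + 0 *: q1 + (k3 * A) *: q2.
  by rewrite r3E eA -/D; apply/rowP => i; rewrite !mxE; ring.
(* [F] packs one column of coefficients, those of a fixed basis vector in [r1], [r2], [r3], into the
   form that [det3_comb4] expects. *)
pose F x y z (i : 'I_3) : C := nth 0 [:: x; y; z] i.
have := det3_comb4 (F 0 (- k2 * d * E) (- k3 * D)) (F (k1 * c * E) 0 0)
  (F (- k1 * a * B * c) (k2 * b * A * c) 0)
  (F (- k1 * a * B * d) (k2 * b * A * d) (k3 * A)) p1 p2 q1 q2.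
rewrite /F /= -r1E -r2E -r3E => ->; rewrite -/A -/B -/G -/D /E.
by ring.
Qed.

End ProjectivePlane.

(** * Concurrency and triple points in a net *)

Lemma ord3_other (i j k l : 'I_3) : i != j -> i != k -> j != k ->
  [|| l == i, l == j | l == k].
Proof. by move: i j k l; do 4!apply: ord3_ind. Qed.

Lemma big_ord3_perm (V : nmodType) (F : 'I_3 -> V) (i j k : 'I_3) :
  i != j -> i != k -> j != k -> \sum_l F l = F i + F j + F k.
Proof.
move=> ij ik jk; rewrite (bigD1 i) //= (bigD1 j) 1?eq_sym //= addrA.
rewrite (big_pred1 k) // => l /=.
have := ord3_other l ij ik jk; case: (eqVneq l k) => [->|_];
  last by rewrite orbF => /orP[]->; rewrite ?andbF.
by rewrite ![k == _]eq_sym ik jk.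
Qed.

(** The candidates for mixed triple points. *)
Definition tset (t : 'I_3 -> 'I_4) : {set netI} := [set x | x.2 == t x.1].

(** A triple inside a class of four lines is coded by the one line that it omits. *)
Definition special (j : 'I_3) (a : 'I_4) : {set netI} :=
  [set x | (x.1 == j) && (x.2 != a)].

Lemma card_special j a : #|special j a| = 3%N.
Proof.
have -> : special j a = setX [set j] [set~ a].
  by apply/setP => -[i b]; rewrite !inE.
by rewrite cardsX cards1 cardsC1 card_ord.
Qed.

Section Arrangement.
Variables (C : numClosedFieldType) (L : netI -> 'rV[C]_3).
Hypothesis L_arr : is_arrangement L.

Definition meet x y : 'rV[C]_3 := cross (L x) (L y).

Lemma meet_neq0 x y : x != y -> meet x y != 0.
Proof.
move=> xy; apply/eqP => /(cross_eq0 (L_arr.1 x))[c yE].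
by have := L_arr.2 y x; rewrite eq_sym => /(_ xy c); rewrite yE eqxx.
Qed.

Lemma meet_l x y : incid (meet x y) (L x). Proof. exact: incid_crossl. Qed.
Lemma meet_r x y : incid (meet x y) (L y). Proof. exact: incid_crossr. Qed.

Lemma lines_through_meet p x y : p != 0 -> x != y ->
  incid p (L x) -> incid p (L y) -> lines_through L p = lines_through L (meet x y).
Proof.
move=> nz_p /meet_neq0 nz px py; apply/setP => z; rewrite !inE.
by rewrite (incid_meet _ nz_p nz px py) incidE.
Qed.

Lemma concurrentS (S S' : {set netI}) : S \subset S' -> concurrent L S' -> concurrent L S.
Proof. by move=> /subsetP sS [p [nz pS]]; exists p; split=> // x /sS/pS. Qed.

Lemma det3_concurrent x y z : x != y -> det3 (L x) (L y) (L z) = 0 ->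
  concurrent L [set x; y; z].
Proof.
move=> xy d0; exists (meet x y); split; first exact: meet_neq0.
move=> w; rewrite !inE => /orP[/orP[]|] /eqP->; rewrite ?meet_l ?meet_r //.
by rewrite incidE; apply/eqP.
Qed.

Lemma concurrent_det3 (S : {set netI}) x y z : concurrent L S ->
  x \in S -> y \in S -> z \in S -> x != y -> det3 (L x) (L y) (L z) = 0.
Proof.
move=> [p [nz pS]] /pS px /pS py /pS pz /meet_neq0 xy.
by apply/eqP; rewrite -(incid_meet _ nz xy px py).
Qed.

(** Only the finitely many intersection points of two lines have to be tried. This makes concurrency
    decidable, so that the triple points form a finite set. *)
Definition concb (S : {set netI}) : bool :=
  [exists x, exists y, (x != y) && (S \subset lines_through L (meet x y))].

Lemma small_subset2 (S : {set netI}) : (#|S| <= 2)%N ->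
  exists x y, x != y /\ S \subset [set x; y].
Proof.
have other (x : netI) : exists y, x != y.
  have : (0 < #|[set~ x]|)%N by rewrite cardsC1 card_prod !card_ord.
  by case/card_gt0P => y; rewrite !inE eq_sym; exists y.
rewrite leq_eqVlt => /orP[/cards2P[x [y [xy ->]]]|].
  by exists x, y; split.
rewrite ltnS leq_eqVlt => /orP[/cards1P[x ->]|].
  by have [y xy] := other x; exists x, y; split=> //; rewrite sub1set set21.
rewrite ltnS leqn0 cards_eq0 => /eqP->.
by have [y xy] := other (0, 0); exists (0, 0), y; split=> //; rewrite sub0set.
Qed.

Lemma concurrentP (S : {set netI}) : reflect (concurrent L S) (concb S).
Proof.
apply: (iffP existsP) => [[x /existsP[y /andP[xy sS]]]|concS].
  exists (meet x y); split; first exact: meet_neq0.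
  by move=> z /(subsetP sS); rewrite inE.
case: (leqP #|S| 1) => [/leqW/small_subset2[x [y [xy sS]]]|].
  exists x; apply/existsP; exists y; rewrite xy; apply: subset_trans sS _.
  by rewrite subUset !sub1set !inE meet_l meet_r.
case/card_gt1P => x [y [xS yS xy]]; exists x; apply/existsP; exists y.
rewrite xy; apply/subsetP => z zS; rewrite inE incidE; apply/eqP.
exact: concurrent_det3 concS xS yS zS xy.
Qed.

Lemma concurrent_small (S : {set netI}) : (#|S| <= 2)%N -> concurrent L S.
Proof.
case/small_subset2 => x [y [xy /subsetP sS]].
exists (meet x y); split=> [|z /sS]; first exact: meet_neq0.
by rewrite !inE => /orP[]/eqP->; rewrite ?meet_l ?meet_r.
Qed.

Lemma net_tripleE t : net_triple L t <-> concurrent L (tset t).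
Proof.
rewrite /net_triple; set S := [set _; _; _]; suff -> : S = tset t by [].
apply/setP => -[i a]; rewrite !inE /= !xpair_eqE.
by move: i; apply: ord3_ind; rewrite !eqxx /= ?orbF.
Qed.

Lemma type_iP j : type_i L j <-> exists a, concurrent L (special j a).
Proof.
split=> [[A [cA concA]]|[a conc_a]].
  have /eqP/cards1P[a aE] : #|~: A| = 1%N.
    by apply: (@addnI #|A|); rewrite cardsC cA card_ord.
  exists a; apply: concurrentS concA; apply/subsetP => -[i b].
  rewrite inE /= => /andP[/eqP-> ba]; apply: imset_f.
  by have := in_setC b A; rewrite aE inE (negPf ba) => /esym/negbFE.
exists [set~ a]; split; first by rewrite cardsC1 card_ord.
apply: concurrentS conc_a; apply/subsetP => _ /imsetP[b ba ->].
by rewrite !inE eqxx in ba *.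
Qed.

Section Net.
Hypotheses (L_net : is_net L) (L_mult : double_or_triple L).

Lemma concurrent_card (S : {set netI}) : concurrent L S -> (#|S| <= 3)%N.
Proof.
move=> [p [nz pS]]; have sS : S \subset lines_through L p.
  by apply/subsetP => x /pS; rewrite inE.
case: (leqP 2 #|S|) => [S2|/ltnW/leqW//].
exact: leq_trans (subset_leq_card sS) (L_mult nz (leq_trans S2 (subset_leq_card sS))).
Qed.

Lemma concurrent_lines (S : {set netI}) : #|S| = 3%N ->
  concurrent L S <-> exists p, p != 0 /\ lines_through L p = S.
Proof.
move=> S3; split=> [[p [nz pS]]|[p [nz <-]]]; exists p; split=> //; last first.
  by move=> x; rewrite inE.
have sS : S \subset lines_through L p by apply/subsetP => x /pS; rewrite inE.
apply/esym/eqP; rewrite eqEcard sS S3; apply: concurrent_card.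
by exists p; split=> // x; rewrite inE.
Qed.

Lemma lines_through_tset p x y : p != 0 -> x.1 != y.1 ->
  incid p (L x) -> incid p (L y) -> exists t : {ffun 'I_3 -> 'I_4}, lines_through L p = tset t.
Proof.
move=> nz xy px py; have one k := L_net xy nz px py k.
have [t tP] : exists t : {ffun 'I_3 -> 'I_4}, forall k a, incid p (L (k, a)) = (a == t k).
  have ex k : exists a, [forall b, incid p (L (k, b)) == (b == a)].
    have /eqP/cards1P[a aE] := one k; exists a; apply/forallP => b.
    by have := in_set1 b a; rewrite -aE inE => ->.
  exists [ffun k => xchoose (ex k)] => k a; rewrite ffunE.
  by have /forallP/(_ a)/eqP := xchooseP (ex k).
by exists t; apply/setP => -[k a]; rewrite !inE tP.
Qed.

(** If the two points coincided, the distinct lines [x] and [z] of one class would pass through the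
    same mixed point, against the net axiom. This supplies the nondegeneracy conditions of Pappus'
    theorem. *)
Lemma meet_meet_neq0 x y z w : x.1 = z.1 -> x != z -> x.1 != y.1 -> z.1 != w.1 ->
  cross (meet x y) (meet z w) != 0.
Proof.
move=> xz1 xz xy zw; have nz : meet x y != 0.
  by apply: meet_neq0; apply: contraNneq xy => ->.
apply/eqP => /(cross_eq0 nz)[c mE].
have [t tE] := lines_through_tset nz xy (meet_l x y) (meet_r x y).
have xt : x \in tset t by rewrite -tE inE meet_l.
have zt : z \in tset t.
  rewrite -tE inE incidE; have := meet_l z w; rewrite incidE mE dotZ mulf_eq0.
  case/orP => [/eqP c0|//]; have /eqP := mE; rewrite c0 scale0r.
  by rewrite (negPf (meet_neq0 _)) //; apply: contraNneq zw => ->.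
move: xt zt xz; rewrite !inE => /eqP xt /eqP zt.
by case: x z xz1 xt zt {xy zw nz mE tE} => [i a] [k b] /= -> -> ->; rewrite eqxx.
Qed.

(** If two of the lines are in different classes, the net axiom puts one line of each class through
    the point. Otherwise all three lie in one class and omit exactly one of its lines. *)
Lemma concurrent3 (S : {set netI}) : #|S| = 3%N -> concurrent L S ->
  (exists t : {ffun 'I_3 -> 'I_4}, S = tset t) \/ exists j a, S = special j a.
Proof.
move=> S3 /(concurrent_lines S3)[p [nz pS]].
case: (boolP [exists x in S, exists y in S, x.1 != y.1]).
  case/existsP => x /andP[xS /existsP[y /andP[yS xy]]]; left; rewrite -pS.
  by apply: (lines_through_tset nz xy); rewrite -pS !inE in xS yS.
rewrite negb_exists => /forallP same; right.
have [x xS] : exists x, x \in S by apply/card_gt0P; rewrite S3.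
have {}same y : y \in S -> y.1 = x.1.
  have := same x; rewrite xS negb_exists => /forallP/(_ y).
  by case: (y \in S) => //=; rewrite negbK => /eqP.
pose A := [set a | (x.1, a) \in S].
have SE : S = [set (x.1, a) | a in A].
  apply/setP => -[i a]; apply/idP/imsetP => [iaS|[b]].
    by exists a; rewrite ?inE -(same _ iaS).
  by rewrite inE => bS [-> ->].
have /eqP/cards1P[a aE] : #|~: A| = 1%N.
  apply: (@addnI #|A|); rewrite cardsC card_ord.
  by rewrite -(card_imset (f := pair x.1) A) -?SE ?S3 // => ? ? [].
exists x.1, a; rewrite SE; apply/setP => -[i b]; rewrite inE /=.
have bA c : (c \in A) = (c != a) by have := in_setC c A; rewrite aE inE => ->; rewrite negbK.
apply/imsetP/andP => [[b' b'A [-> ->]]|[/eqP-> ba]]; last by exists b; rewrite ?bA.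
by rewrite eqxx -bA.
Qed.

Definition marks : {set netI} := [set x | concb (special x.1 x.2)].

Lemma marksP j a : reflect (concurrent L (special j a)) ((j, a) \in marks).
Proof. by rewrite inE; apply: concurrentP. Qed.

(** If a class had two marks [a] and [a'], its other two lines would belong to both concurrent
    triples. All four lines would then pass through one point, which the multiplicity bound
    forbids. *)
Lemma marks_inj : {in marks &, injective fst}.
Proof.
move=> [j a] [j' a'] /marksP ja /marksP ja' /= jj'; rewrite -{}jj' in ja' *.
congr (_, _).
apply/eqP; apply: contraT => aa'.
have : (1 < #|~: [set a; a']|)%N.
  by rewrite -(ltn_add2l #|[set a; a']|) cardsC card_ord cards2 aa'.
case/card_gt1P => b [b' []]; rewrite !inE !negb_or => /andP[ba ba'] /andP[b'a b'a'] bb'.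
have jbb' : (j, b) != (j, b') by rewrite xpair_eqE eqxx.
have on c : incid (meet (j, b) (j, b')) (L (j, c)).
  have in_special d : d != a -> (j, d) \in special j a by rewrite inE eqxx.
  have in_special' d : d != a' -> (j, d) \in special j a' by rewrite inE eqxx.
  rewrite incidE; apply/eqP; case: (eqVneq c a) => [->|ca].
    by apply: concurrent_det3 ja' _ _ _ jbb'; apply: in_special'.
  by apply: concurrent_det3 ja _ _ _ jbb'; apply: in_special.
have : concurrent L [set (j, c) | c : 'I_4].
  exists (meet (j, b) (j, b')); split; first exact: meet_neq0.
  by move=> _ /imsetP[c _ ->].
by move/concurrent_card; rewrite card_imset ?card_ord // => ? ? [].
Qed.

Definition types_i : {set 'I_3} := [set x.1 | x in marks].

Lemma types_iP j : type_i L j <-> j \in types_i.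
Proof.
split=> [/type_iP[a /marksP ja]|/imsetP[[k a] /marksP ja ->]].
  exact: (imset_f fst ja).
by apply/type_iP; exists a.
Qed.

Definition triple_points : {set {set netI}} :=
  [set S : {set netI} | (#|S| == 3%N) && concb S].

Lemma triple_pointsP (S : {set netI}) :
  (S \in triple_points) <-> #|S| = 3%N /\ concurrent L S.
Proof.
rewrite inE; split=> [/andP[/eqP ? /concurrentP]|[-> /concurrentP->]] //.
Qed.

Lemma triple_points_num n : num_triple_points L n <-> n = #|triple_points|.
Proof.
have tpE (S : {set netI}) : S \in triple_points <->
    #|S| = 3%N /\ exists p, p != 0 /\ lines_through L p = S.
  by split=> [/triple_pointsP[S3]|[S3]] h; [split|apply/triple_pointsP; split];
    rewrite // ?(concurrent_lines S3) // -concurrent_lines.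
split=> [[T [<- TP]]|->]; last by exists triple_points.
by apply: eq_card => S; apply/idP/idP => [/TP/tpE|/tpE/TP].
Qed.

(** The mixed triple points are indexed by the 16 pairs of a line of class 0 and a line of class 1.
    The others are indexed by the marks, of which each class of type (i) has exactly one. *)
Lemma card_triple_points : #|triple_points| = (16 + #|types_i|)%N.
Proof.
pose F (ab : 'I_4 * 'I_4) := lines_through L (meet (0, ab.1) (1, ab.2)).
have FE ab : exists t, [/\ F ab = tset t, t 0 = ab.1 & t 1 = ab.2].
  have nz : meet (0, ab.1) (1, ab.2) != 0 by apply: meet_neq0.
  have [//|t tE] := lines_through_tset nz _ (meet_l _ _) (meet_r _ _).
  exists t; split=> //; apply/esym/eqP.
    by have := meet_l (0, ab.1) (1, ab.2); have /setP/(_ (0, ab.1)) := tE; rewrite !inE => ->.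
  by have := meet_r (0, ab.1) (1, ab.2); have /setP/(_ (1, ab.2)) := tE; rewrite !inE => ->.
have tset_inj (t u : 'I_3 -> 'I_4) : tset t = tset u -> t =1 u.
  by move/setP => tu i; have := tu (i, t i); rewrite !inE eqxx => /esym/eqP.
have F_inj : injective F.
  move=> [a b] [a' b']; have [t [-> /= <- <-]] := FE (a, b).
  by have [u [-> /= <- <-]] := FE (a', b') => /tset_inj tu; rewrite !tu.
have tset_special (t : 'I_3 -> 'I_4) j a : tset t != special j a.
  apply/eqP => /setP tj; have := tj (j + 1, t (j + 1)); rewrite !inE eqxx /=.
  by rewrite -subr_eq0 addrAC subrr add0r.
have card_tset (t : 'I_3 -> 'I_4) : #|tset t| = 3%N.
  have -> : tset t = [set (i, t i) | i : 'I_3].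
    apply/setP => -[i a]; rewrite inE /=; apply/eqP/imsetP => [->|[k _ [-> ->]]] //.
    by exists i.
  by rewrite card_imset ?card_ord // => ? ? [].
have -> : triple_points = [set F ab | ab : 'I_4 * 'I_4] :|: [set special x.1 x.2 | x in marks].
  apply/setP => S; apply/idP/setUP.
    case/triple_pointsP => S3 concS; case: (concurrent3 S3 concS) => [[t SE]|[j [a SE]]].
      left; apply/imsetP; exists (t 0, t 1) => //; rewrite SE.
      have [p [nz pS]] : exists p, p != 0 /\ lines_through L p = S by apply/concurrent_lines.
      have ont i : incid p (L (i, t i)) by have /setP/(_ (i, t i)) := pS; rewrite SE !inE eqxx.
      by rewrite /F -(lines_through_meet nz _ (ont 0) (ont 1)) ?pS.
    by right; apply/imsetP; exists (j, a) => //; apply/marksP; rewrite -SE.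
  case=> [/imsetP[ab _ ->]|/imsetP[[j a] /marksP ja ->]]; apply/triple_pointsP.
    split; first by have [t [->]] := FE ab.
    by exists (meet (0, ab.1) (1, ab.2)); split; [apply: meet_neq0|move=> x; rewrite inE].
  by rewrite card_special.
rewrite cardsU (_ : _ :&: _ = set0) ?cards0 ?subn0; last first.
  apply/setP => S; rewrite !inE; apply/andP => -[/imsetP[ab _ ->] /imsetP[x _]].
  by have [t [-> _ _]] := FE ab => /eqP; apply/negP.
rewrite (card_imset _ F_inj) card_prod card_ord (card_in_imset marks_inj); congr addn.
apply: card_in_imset => x y xm ym /setP xy; apply: marks_inj => //.
have [b xb] : exists b, b != x.2.
  by have : (0 < #|[set~ x.2]|)%N;
    [rewrite cardsC1 card_ord|case/card_gt0P => b; rewrite !inE; exists b].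
by have := xy (x.1, b); rewrite !inE eqxx xb => /esym/andP[/eqP].
Qed.

End Net.
End Arrangement.

(** * Labelling by a group of order 4 *)

Section Labels.
Variables (G : finZmodType) (G4 : #|G| = 4%N).

Definition total : G := \sum_g g.

(** Negation permutes the group, so [total] equals its own opposite. *)
Lemma totalD : total + total = 0.
Proof.
have totalN : total = - total.
  by rewrite {1}/total (reindex_inj (@oppr_inj G)) sumrN.
by rewrite {1}totalN addNr.
Qed.

Lemma nonzero_elements : exists u1 u2 u3 : G,
  [/\ uniq [:: u1; u2; u3], forall g, (g != 0) = (g \in [:: u1; u2; u3])
    & total = u1 + u2 + u3].
Proof.
have G0 : (0 : G) \in enum G by rewrite mem_enum.
have := perm_to_rem G0; set s := rem _ _ => Gs.
have s3 : size s = 3%N by rewrite size_rem // -cardE G4.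
have s_uniq : uniq (0 :: s) by rewrite -(perm_uniq Gs) enum_uniq.
have s_mem g : (g != 0) = (g \in s).
  have := perm_mem Gs g; rewrite mem_enum !inE => /esym.
  by case: eqVneq => [-> _|//]; case/andP: s_uniq => /negPf->.
have s_sum : total = \sum_(g <- s) g.
  by rewrite /total -big_enum (perm_big _ Gs) big_cons /= add0r.
case: s s3 s_uniq s_mem s_sum {Gs} => [|u1 [|u2 [|u3 [|]]]] //= _ /andP[_ su] sm ss.
by exists u1, u2, u3; split; rewrite // ss !big_cons big_nil addr0 addrA.
Qed.

Definition labeling (C : numClosedFieldType) (L : netI -> 'rV[C]_3)
    (e : 'I_3 -> 'I_4 -> G) (e' : 'I_3 -> G -> 'I_4) :=
  [/\ forall i, cancel (e i) (e' i), forall i, cancel (e' i) (e i)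
    & forall t, net_triple L t <-> \sum_i e i (t i) = 0].

Section Net.
Variables (C : numClosedFieldType) (L : netI -> 'rV[C]_3).
Variables (e : 'I_3 -> 'I_4 -> G) (e' : 'I_3 -> G -> 'I_4).
Hypotheses (L_arr : is_arrangement L) (L_net : is_net L).
Hypotheses (L_mult : double_or_triple L) (Le : labeling L e e').

Lemma labelK i : cancel (e i) (e' i). Proof. by case: Le. Qed.
Lemma labelVK i : cancel (e' i) (e i). Proof. by case: Le. Qed.

Lemma label_tset t : concurrent L (tset t) <-> \sum_i e i (t i) = 0.
Proof. by rewrite -net_tripleE; case: Le. Qed.

Lemma label_det3 i j k a b c : i != j -> i != k -> j != k -> a + b + c = 0 ->
  det3 (L (i, e' i a)) (L (j, e' j b)) (L (k, e' k c)) = 0.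
Proof.
move=> ij ik jk abc.
(* The last default value is taken only at [l = k], the remaining class. *)
pose t l := e' l (if l == i then a else if l == j then b else c).
have ti : t i = e' i a by rewrite /t eqxx.
have tj : t j = e' j b by rewrite /t eq_sym (negPf ij) eqxx.
have tk : t k = e' k c by rewrite /t ![k == _]eq_sym (negPf ik) (negPf jk).
have /label_tset conc : \sum_l e l (t l) = 0.
  by rewrite (big_ord3_perm _ ij ik jk) ti tj tk !labelVK.
apply: (concurrent_det3 L_arr conc); rewrite ?inE /= ?ti ?tj ?tk //.
by rewrite xpair_eqE negb_and ij.
Qed.

(* With u1, u2, u3 the nonzero elements of G, the lines labelled a + u_n in class
   i and b + u_n in class j are the two pencils of a dual Pappus configuration,
   whose third pencil consists of the lines labelled total - a - b + u_n. *)
Lemma special_third i j k a b : i != j -> i != k -> j != k ->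
  concurrent L (special i (e' i a)) -> concurrent L (special j (e' j b)) ->
  concurrent L (special k (e' k (total - a - b))).
Proof.
move=> ij ik jk conc_i conc_j; have [u1 [u2 [u3 [su sm st]]]] := nonzero_elements.
have /and3P[/norP[/= u12 /norP[u13 _]] /norP[/= u23 _] _] := su.
have nz u : u \in [:: u1; u2; u3] -> u != 0 by rewrite sm.
have [nz1 nz2 nz3] : [/\ u1 != 0, u2 != 0 & u3 != 0].
  by split; apply: nz; rewrite !inE eqxx ?orbT.
pose N l g := (l, e' l g) : netI; set c := total - a - b.
have N_inj l g h : g != h -> N l g != N l h.
  by apply: contra_neq => -[] /(can_inj (labelVK l)).
have shift (x y z : G) : y != z -> x + y != x + z by rewrite (inj_eq (addrI x)).
have in_special l x u : u != 0 -> N l (x + u) \in special l (e' l x).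
  move=> nzu; rewrite inE eqxx /= (can_eq (labelVK l)).
  by rewrite -subr_eq0 addrC addKr.
have pencil l x : concurrent L (special l (e' l x)) ->
    det3 (L (N l (x + u1))) (L (N l (x + u2))) (L (N l (x + u3))) = 0.
  move=> conc; apply: (concurrent_det3 L_arr conc); try exact: in_special.
  exact/N_inj/shift.
(* The three labels add up to [total + (x + y + z)], which is twice [total], hence zero. *)
have grid x y z : x + y + z = total ->
    det3 (L (N i (a + x))) (L (N j (b + y))) (L (N k (c + z))) = 0.
  move=> xyz; apply: label_det3 => //; rewrite /c.
  rewrite [a + x + _]addrACA -[total - a - b]addrA -opprD [LHS]addrACA xyz [X in X + _]addrC.
  by rewrite subrK totalD.
have nzx l x y z : y != z -> cross (L (N l (x + y))) (L (N l (x + z))) != 0.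
  by move=> yz; apply: meet_neq0 => //; apply/N_inj/shift.
have nzm x y z w : x != z ->
    cross (cross (L (N i (a + x))) (L (N j (b + y))))
          (cross (L (N i (a + z))) (L (N j (b + w)))) != 0.
  by move=> xz; apply: meet_meet_neq0 => //; apply/N_inj/shift.
(* The vectors p_n, q_n, r_n of [pappus] are the lines labelled a + u_n, b + u_n, c + u_n. Each of
   its six cross incidences involves the three different indices, so the offsets add up to [total]
   and [grid] applies. *)
have d0 : det3 (L (N k (c + u1))) (L (N k (c + u2))) (L (N k (c + u3))) = 0.
  apply: (pappus (nzx i a _ _ u12) (pencil _ _ conc_i) (nzx j b _ _ u12)
    (pencil _ _ conc_j) (nzm u2 u3 u3 u2 u23) _ _ (nzm u1 u3 u3 u1 u13) _ _
    (nzm u1 u2 u2 u1 u12)); apply: grid; rewrite st.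
  - by rewrite [LHS]addrC addrA.
  - by rewrite [u3 + u2]addrC [LHS]addrC addrA.
  - by rewrite addrAC.
  - by rewrite [u3 + u1]addrC addrAC.
  - by [].
  - by rewrite [u2 + u1]addrC.
apply: (concurrentS _ (det3_concurrent L_arr (N_inj k _ _ (shift c _ _ u12)) d0)).
apply/subsetP => -[l d]; rewrite !inE => /andP[/= /eqP-> dc].
rewrite !xpair_eqE !eqxx /= -!(can_eq (labelK k)) !labelVK.
(* Every label other than [c] differs from it by a nonzero element, that is by one of the [u]'s. *)
have : e k d - c != 0 by rewrite subr_eq0 -(can_eq (labelVK k)) labelK.
by rewrite sm !inE !subr_eq ![_ + c]addrC orbA.
Qed.

Lemma marks_third i j k a b : i != j -> i != k -> j != k ->
  (i, a) \in marks L -> (j, b) \in marks L ->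
  (k, e' k (total - e i a - e j b)) \in marks L.
Proof.
move=> ij ik jk /(marksP L_arr) ia /(marksP L_arr) jb; apply/(marksP L_arr).
by apply: (special_third ij ik jk); rewrite labelK.
Qed.

Lemma card_types_i : (#|types_i L| != 0)%N -> (#|types_i L| != 1)%N -> types_i L = setT.
Proof.
move=> n0 n1; have : (1 < #|types_i L|)%N by case: #|_| n0 n1 => [|[]].
case/card_gt1P => _ [_ [/imsetP[[i a] ia ->] /imsetP[[j b] jb ->] /= ij]].
apply/setP => k; rewrite inE; case: (eqVneq k i) => [->|ki]; first exact: (imset_f fst ia).
case: (eqVneq k j) => [->|kj]; first exact: (imset_f fst jb).
rewrite eq_sym in ki; rewrite eq_sym in kj.
exact: (imset_f fst (marks_third ij ki kj ia jb)).
Qed.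

(** By uniqueness, the mark of the third class is the one that Pappus' theorem yields from the other
    two. *)
Lemma sum_marks (m : 'I_3 -> 'I_4) : (forall j, (j, m j) \in marks L) ->
  \sum_j e j (m j) = total.
Proof.
move=> mP; have := marks_third (i := 0) (j := 1) (k := 2%:R) isT isT isT (mP 0) (mP 1).
move/(marks_inj L_arr L_mult)/(_ (mP 2%:R) erefl)/(congr1 snd) => /= mE.
by rewrite big_ord3 -mE labelVK -[total - _ - _]addrA -opprD addrC subrK.
Qed.

End Net.
End Labels.

(** * Lattice isomorphisms *)

(** Lets the Klein group ['I_2 * 'I_2] serve as a group of labels. *)
HB.instance Definition _ (U V : finZmodType) := Finite.on (U * V)%type.

Lemma ord4_ind (P : 'I_4 -> Prop) :
  P (inZp 0) -> P (inZp 1) -> P (inZp 2) -> P (inZp 3) -> forall i, P i.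
Proof.
move=> P0 P1 P2 P3 [[|[|[|[|//]]]] lt_i];
  [move: P0 | move: P1 | move: P2 | move: P3]; congr P; exact: val_inj.
Qed.

(** With indices from 0, [M1] is addition modulo 4, so symbols get a minus sign to make the sum
    zero. [M2] is bitwise addition of two binary digits, where every element is its own opposite. *)
Lemma group_of_square (M : seq (seq nat)) : M = M1 \/ M = M2 ->
  exists (G : finZmodType) (h : 'I_3 -> 'I_4 -> G) (h' : 'I_3 -> G -> 'I_4),
  [/\ #|G| = 4%N, forall i, cancel (h i) (h' i), forall i, cancel (h' i) (h i)
    & forall t, ls_triple M t <-> \sum_i h i (t i) = 0].
Proof.
case=> ->.
  pose h (i : 'I_3) (a : 'I_4) := if i == 2%:R then - a else a.
  have hK i : cancel (h i) (h i) by move=> a; rewrite /h; case: (i == _); rewrite /= ?opprK.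
  exists 'I_4, h, h; split=> // [|t]; first exact: card_ord.
  rewrite big_ord3 /ls_triple /h /=.
  suff tE (a b c : 'I_4) : (c == ls_entry M1 a b :> nat) = (a + b - c == 0 :> 'I_4).
    have E := tE (t 0) (t 1) (t 2%:R).
    by split=> /eqP tM; apply/eqP; [exact: etrans (esym E) tM | exact: etrans E tM].
  by move: a b c; do 3!apply: ord4_ind.
(* The low and the high binary digit of [a]; [inZp] reduces modulo 2. *)
pose h (i : 'I_3) (a : 'I_4) : 'I_2 * 'I_2 := (inZp a, inZp a./2).
pose h' (i : 'I_3) (x : 'I_2 * 'I_2) : 'I_4 := inZp (x.1 + (x.2).*2).
exists ('I_2 * 'I_2)%type, h, h'; split=> [|i|i|t].
- by rewrite card_prod !card_ord.
- by apply: ord4_ind; apply: val_inj.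
- by move=> [[[|[|//]] ?] [[|[|//]] ?]]; congr (_, _); apply: val_inj.
rewrite big_ord3 /ls_triple /h /=.
suff tE (a b c : 'I_4) : (c == ls_entry M2 a b :> nat) = (h 0 a + h 0 b + h 0 c == 0).
  have E := tE (t 0) (t 1) (t 2%:R).
  by split=> /eqP tM; apply/eqP; [exact: etrans (esym E) tM | exact: etrans E tM].
by move: a b c; do 3!apply: ord4_ind.
Qed.

(** Class [j] plays the role [tau^-1 j] in [M], so its lines take their labels from there through
    [sigma]. The group is chosen before the net, so two nets of the same main class can be compared
    by their labels. *)
Lemma labeling_of_square (M : seq (seq nat)) : M = M1 \/ M = M2 ->
  exists G : finZmodType, #|G| = 4%N /\
  forall (C : numClosedFieldType) (L : netI -> 'rV[C]_3), in_main_class L M ->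
  exists (e : 'I_3 -> 'I_4 -> G) e', labeling L e e'.
Proof.
move=> /group_of_square[G [h [h' [G4 hK h'K hM]]]]; exists G; split=> // C L.
case=> tau [sigma LM].
exists (fun j a => h (tau^-1%g j) (sigma (tau^-1%g j) a)).
exists (fun j g => (sigma (tau^-1%g j))^-1%g (h' (tau^-1%g j) g)).
split=> [i a|i g|t]; rewrite ?hK ?permK ?permKV ?h'K //.
rewrite LM hM [X in _ <-> X = _](reindex_inj (@perm_inj _ tau)) /=.
by under [X in _ <-> X = _]eq_bigr => i _ do rewrite permK.
Qed.

Section Iso.
Variables (G : finZmodType) (G4 : #|G| = 4%N) (C : numClosedFieldType).
Variables (L L' : netI -> 'rV[C]_3).
Variables (e d : 'I_3 -> 'I_4 -> G) (e' d' : 'I_3 -> G -> 'I_4).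
Hypotheses (L_arr : is_arrangement L) (L_net : is_net L).
Hypotheses (L_mult : double_or_triple L) (Le : labeling L e e').
Hypotheses (L'_arr : is_arrangement L') (L'_net : is_net L').
Hypotheses (L'_mult : double_or_triple L') (L'd : labeling L' d d').
Hypothesis same_types : #|types_i L| = #|types_i L'|.

(** Permuting the classes and translating labels by a zero-sum family preserves mixed triples, and
    the hypothesis on marks handles the triples inside a class. Triple points thus inject into
    triple points; as both nets have equally many, concurrency is also reflected. *)
Lemma iso_of_marks (pi : {perm 'I_3}) (c : 'I_3 -> G) : \sum_j c j = 0 ->
  (forall j a, (j, a) \in marks L -> (pi j, d' (pi j) (e j a + c j)) \in marks L') ->
  lattice_iso L L'.
Proof.
move=> c0 pi_marks.
pose f0 (x : netI) : netI := (pi x.1, d' (pi x.1) (e x.1 x.2 + c x.1)).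
have f0_inj : injective f0.
  move=> [i a] [j b] [/perm_inj ij]; rewrite {}ij.
  by move=> /(can_inj (labelVK L'd _))/addIr/(can_inj (labelK Le _)) ->.
pose f := perm f0_inj.
have fE x : f x = f0 x by rewrite permE.
have f_inj : injective f by apply: perm_inj.
have fT S : S \in triple_points L -> f @: S \in triple_points L'.
  move/(triple_pointsP L_arr) => [S3 concS]; apply/(triple_pointsP L'_arr).
  split; first by rewrite card_imset.
  case: (concurrent3 L_net L_mult S3 concS) => [[t SE]|[j [a SE]]].
    pose t' k := d' k (e (pi^-1%g k) (t (pi^-1%g k)) + c (pi^-1%g k)).
    apply: (@concurrentS _ _ _ (tset t')).
      apply/subsetP => _ /imsetP[x + ->]; rewrite SE fE !inE /= => /eqP->.
      by rewrite /t' permK.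
    apply/(label_tset L'd); rewrite (reindex_inj (@perm_inj _ pi)).
    under eq_bigr => i _ do rewrite /t' (labelVK L'd) permK.
    by rewrite big_split /= c0 addr0; apply/(label_tset Le); rewrite -SE.
  have /pi_marks/(marksP L'_arr) : (j, a) \in marks L.
    by apply/(marksP L_arr); rewrite -SE.
  apply: concurrentS; apply/subsetP => _ /imsetP[x + ->].
  rewrite SE fE !inE /= => /andP[/eqP-> xa]; rewrite eqxx (can_eq (labelVK L'd _)).
  by rewrite (inj_eq (addIr _)) (can_eq (labelK Le _)).
have T'E : [set f @: (S : {set netI}) | S in triple_points L] = triple_points L'.
  apply/eqP; rewrite eqEcard; apply/andP; split.
    by apply/subsetP => _ /imsetP[S ST ->]; apply: fT.
  rewrite card_imset; last exact: imset_inj.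
  by rewrite !card_triple_points // same_types.
(* At most two lines are always concurrent and more than three never are, so only triples matter. *)
exists f => S; case: (leqP #|S| 2) => [S2|S3].
  by split=> _; apply: concurrent_small; rewrite // card_imset.
split=> concS.
  have SS : #|S| = 3%N by apply/eqP; rewrite eqn_leq S3 (concurrent_card L_mult concS).
  by have /(triple_pointsP L'_arr)[] : f @: S \in triple_points L'
    by apply/fT/(triple_pointsP L_arr).
have SS : #|f @: S| = 3%N.
  by apply/eqP; rewrite eqn_leq (concurrent_card L'_mult concS) card_imset.
have : f @: S \in triple_points L' by apply/(triple_pointsP L'_arr).
by rewrite -T'E => /imsetP[S' + /(imset_inj f_inj) ->] => /(triple_pointsP L_arr)[].
Qed.

Lemma iso_of_types : lattice_iso L L'.
Proof.
case: (eqVneq #|types_i L| 0) => [T0|Tn0].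
  apply: (@iso_of_marks 1 (fun=> 0)) => [|j a ja]; first by rewrite big1.
  have : j \in types_i L by apply: (imset_f fst ja).
  by rewrite (cards0_eq T0) inE.
case: (eqVneq #|types_i L| 1%N) => [T1|Tn1].
  have /eqP/cards1P[k TE] := T1.
  have /eqP/cards1P[k' T'E] : #|types_i L'| = 1%N by rewrite -same_types.
  have /imsetP[[_k a] ka /= kE] : k \in types_i L by rewrite TE set11.
  have /imsetP[[_k' a'] ka' /= k'E] : k' \in types_i L' by rewrite T'E set11.
  rewrite -{}kE -{}k'E in ka ka' *.
  pose x := d k' a' - e k a; pose k1 := k + 1; pose k2 := k + 2%:R.
  have [kk1 kk2 k12] : [/\ k != k1, k != k2 & k1 != k2].
    by rewrite /k1 /k2; move: (k); apply: ord3_ind.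
  (* The marked class is moved to the marked class and translated by the difference [x] of the
     marks; the [- x] in a class without mark restores the zero sum. *)
  apply: (@iso_of_marks (tperm k k')
    (fun j => if j == k then x else if j == k1 then - x else 0)).
    rewrite (big_ord3_perm _ kk1 kk2 k12) !eqxx (eq_sym k1 k).
    rewrite (eq_sym k2 k) (eq_sym k2 k1).
    by rewrite (negPf kk1) (negPf kk2) (negPf k12) addr0 subrr.
  move=> j b jb; have : j \in types_i L by apply: (imset_f fst jb).
  rewrite TE inE => /eqP jk; rewrite {}jk in jb *.
  have /(congr1 snd) /= -> := marks_inj L_arr L_mult jb ka erefl.
  by rewrite eqxx tpermL addrC subrK (labelK L'd).
have TE := card_types_i G4 L_arr L_net Le Tn0 Tn1.
rewrite same_types in Tn0 Tn1.
have T'E := card_types_i G4 L'_arr L'_net L'd Tn0 Tn1.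
have ex j : exists a, (j, a) \in marks L.
  by have := in_setT j; rewrite -TE => /imsetP[[i a] ia ->]; exists a.
have ex' j : exists a, (j, a) \in marks L'.
  by have := in_setT j; rewrite -T'E => /imsetP[[i a] ia ->]; exists a.
pose m j := xchoose (ex j); pose m' j := xchoose (ex' j).
have mP j : (j, m j) \in marks L := xchooseP (ex j).
have m'P j : (j, m' j) \in marks L' := xchooseP (ex' j).
(* Each class is translated from its mark to the new one. The marks add up to [total] in both nets,
   so these translations add up to zero. *)
apply: (@iso_of_marks 1 (fun j => d j (m' j) - e j (m j))) => [|j a ja].
  rewrite sumrB (sum_marks G4 L_arr L_net L_mult Le mP).
  by rewrite (sum_marks G4 L'_arr L'_net L'_mult L'd m'P) subrr.
have /(congr1 snd) /= -> := marks_inj L_arr L_mult ja (mP j) erefl.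
by rewrite perm1 addrC subrK (labelK L'd).
Qed.
End Iso.

(** * The three situations and the number of classes of type (i) *)

Section Classification.
Variables (C : numClosedFieldType) (L : netI -> 'rV[C]_3).
Hypothesis L_arr : is_arrangement L.

(** The order is that of [situation]: none, all, exactly one. *)
Definition num_types (s : 'I_3) : nat := nth 0 [:: 0; 3; 1]%N s.

Lemma situationP s : situation L s -> #|types_i L| = num_types s.
Proof.
have mem j := types_iP L_arr j.
case: s => [[|[|[|//]]] lt_s]; rewrite /situation /num_types /= => sit.
- by apply/eqP; rewrite cards_eq0; apply/eqP/setP => j; rewrite inE; apply/negP => /mem/sit.
- rewrite (_ : types_i L = setT) ?cardsT ?card_ord //.
  by apply/setP => j; rewrite inE; apply/mem/sit.
- have [j [ji jo]] := sit; rewrite (_ : types_i L = [set j]) ?cards1 //.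
  apply/setP => i; rewrite inE; apply/idP/eqP => [/mem ii|->]; last exact/mem.
  by apply/eqP; apply: contraT => /jo/(_ ii).
Qed.

Lemma situation_of_num_types s : #|types_i L| = num_types s -> situation L s.
Proof.
have mem j := types_iP L_arr j.
case: s => [[|[|[|//]]] lt_s]; rewrite /situation /num_types /= => T.
- by move=> j /mem; rewrite (cards0_eq T) inE.
- have /eqP TE : types_i L == setT by rewrite eqEcard subsetT T cardsT card_ord.
  by move=> j; apply/mem; rewrite TE inE.
- have /eqP/cards1P[j TE] := T; exists j.
  split=> [|i ij]; first by apply/mem; rewrite TE set11.
  by move/mem; rewrite TE inE; apply/negP.
Qed.
End Classification.

Lemma card_types_good (C : numClosedFieldType) M (L : netI -> 'rV[C]_3) :
  M = M1 \/ M = M2 -> good_net L M ->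
  exists s : 'I_3, #|types_i L| = num_types s.
Proof.
move=> MM [L_arr L_net L_mult LM].
have [G [G4 /(_ C L LM)[e [e' Le]]]] := labeling_of_square MM.
case: (eqVneq #|types_i L| 0) => [->|n0]; first by exists 0.
case: (eqVneq #|types_i L| 1) => [->|n1]; first by exists 2%:R.
by exists 1; rewrite (card_types_i G4 L_arr L_net Le n0 n1) cardsT card_ord.
Qed.

Lemma iso_good (C : numClosedFieldType) M (L L' : netI -> 'rV[C]_3) :
  M = M1 \/ M = M2 -> good_net L M -> good_net L' M ->
  #|types_i L| = #|types_i L'| -> lattice_iso L L'.
Proof.
move=> MM [L_arr L_net L_mult LM] [L'_arr L'_net L'_mult L'M] same.
have [G [G4 lab]] := labeling_of_square MM.
have [e [e' Le]] := lab C L LM; have [d [d' L'd]] := lab C L' L'M.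
exact: (iso_of_types G4 L_arr L_net L_mult Le L'_arr L'_net L'_mult L'd).
Qed.

(** * Realizations *)

Section Realization.

Local Open Scope Z_scope.

(* The lines are dual to points of a plane cubic with a flex as origin: the three
   classes are cosets a + H, b + H and - (a + b) + H of a subgroup H of order 4,
   which is Z/4 or (Z/2)^2.  Since three points are collinear iff they sum to 0,
   the class x + H is of type (i) iff 3x belongs to H.  [table1_1] lives on the
   acnodal cubic y^2 z = x^2 (x - z), [table1_2] on a curve with rational torsion
   Z/12 and [table2_2] on one with rational torsion Z/2 x Z/6, up to linear
   changes of coordinates. *)
Definition table1_1 : seq (seq (Z * Z * Z)) := [::
  [:: (8, 4, -3); (1, 1, 6); (6, -1, 3); (15, -3, -2)];
  [:: (48, 136, -75); (123, 51, 100); (74, -17, 150); (109, -17, -12)];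
  [:: (826, -119, -39); (47, -17, 546); (600, 204, 91); (273, -221, 42)]].

Definition table1_2 : seq (seq (Z * Z * Z)) := [::
  [:: (0, 1, 0); (2, 3, 2); (1, 1, -1); (1, 0, 1)];
  [:: (4, -3, -8); (1, -2, 3); (7, -9, 1); (4, 7, 2)];
  [:: (1, 3, -2); (1, 3, 3); (7, 21, 1); (8, -1, 4)]].

Definition table1_3 : seq (seq (Z * Z * Z)) := [::
  [:: (0, 1, 0); (1, -1, -1); (3, -1, 3); (1, 1, -1)];
  [:: (3, -1, -1); (2, -2, 1); (0, 1, -3); (5, 5, 1)];
  [:: (9, 1, -3); (2, 1, 1); (0, 0, 1); (5, -7, 1)]].

Definition table2_1 : seq (seq (Z * Z * Z)) := [::
  [:: (10, -2, 1); (1, -1, 2); (2, 2, 7); (5, 1, -3)];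
  [:: (5, -6, 38); (48, -8, -29); (36, 6, 1); (20, 24, 13)];
  [:: (350, -22, -325); (11, -35, 694); (242, 770, -137); (1225, 77, 249)]].

Definition table2_2 : seq (seq (Z * Z * Z)) := [::
  [:: (1, 3, 4); (1, -3, 1); (1, -1, 0); (1, 1, -1)];
  [:: (1, -3, 4); (1, 3, 1); (1, 1, 0); (1, -1, -1)];
  [:: (0, 1, 0); (0, 0, 1); (1, 0, -2); (4, 0, 1)]].

Definition table2_3 : seq (seq (Z * Z * Z)) := [::
  [:: (0, 1, 0); (1, 0, -1); (0, 0, 1); (1, 0, 2)];
  [:: (1, -2, -2); (2, -6, 1); (1, 2, 1); (1, 3, -4)];
  [:: (1, 2, -2); (2, 6, 1); (1, -2, 1); (1, -3, -4)]].

End Realization.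

(** * Checking integer tables by computation *)

Definition zdet (u v w : Z * Z * Z) : Z :=
  (u.1.2 * v.2 - u.2 * v.1.2) * w.1.1 + (u.2 * v.1.1 - u.1.1 * v.2) * w.1.2
  + (u.1.1 * v.1.2 - u.1.2 * v.1.1) * w.2.

Definition zentry (T : seq (seq (Z * Z * Z))) (x : nat * nat) : Z * Z * Z :=
  nth 0 (nth [::] T x.1) x.2.

Definition zconc T x y z := zdet (zentry T x) (zentry T y) (zentry T z) == 0.

Definition zspecial T j a :=
  let r := rem a (iota 0 4) in zconc T (j, nth 0 r 0)%N (j, nth 0 r 1)%N (j, nth 0 r 2)%N.

Definition zindices := [seq (j, a) | j <- iota 0 3, a <- iota 0 4].

(** The clauses certify, in turn: distinct lines are not proportional, witnessed by a third line
    with nonzero determinant, and at most three lines pass through their meet; the net axiom; the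
    Latin square is [M] itself; [s] classes are of type (i). *)
Definition ztable_ok M (T : seq (seq (Z * Z * Z))) (s : nat) : bool :=
  let pairs := [seq (x, y) | x <- zindices, y <- zindices] in
  [&& all (fun xy => (xy.1 != xy.2) ==>
         has (fun z => ~~ zconc T xy.1 xy.2 z) zindices
         && (sumn [seq count (fun a => zconc T xy.1 xy.2 (j, a)) (iota 0 4)
                  | j <- iota 0 3] <= 3)%N) pairs,
      all (fun xy => (xy.1.1 != xy.2.1) ==>
         all (fun k => count (fun a => zconc T xy.1 xy.2 (k, a)) (iota 0 4) == 1%N)
           (iota 0 3)) pairs,
      all (fun xy => all (fun c => zconc T (0%N, xy.1.2) (1%N, xy.2.2) (2%N, c)
         == (c == ls_entry M xy.1.2 xy.2.2)) (iota 0 4)) pairs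
    & count (fun j => has (zspecial T j) (iota 0 4)) (iota 0 3) == s].

Lemma ztable1_1_ok : ztable_ok M1 table1_1 0. Proof. by vm_compute. Qed.
Lemma ztable1_2_ok : ztable_ok M1 table1_2 3. Proof. by vm_compute. Qed.
Lemma ztable1_3_ok : ztable_ok M1 table1_3 1. Proof. by vm_compute. Qed.
Lemma ztable2_1_ok : ztable_ok M2 table2_1 0. Proof. by vm_compute. Qed.
Lemma ztable2_2_ok : ztable_ok M2 table2_2 3. Proof. by vm_compute. Qed.
Lemma ztable2_3_ok : ztable_ok M2 table2_3 1. Proof. by vm_compute. Qed.

Lemma all_iotaP n (P : pred nat) : all P (iota 0 n) -> forall i : 'I_n, P i.
Proof. by move/allP => h i; apply: h; rewrite mem_iota /=. Qed.

Lemma card_iota n (P : pred nat) : #|[set i : 'I_n | P i]| = count P (iota 0 n).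
Proof.
by rewrite cardsE -sum1_card -(big_mkord P (fun=> 1%N)) sum1_count /index_iota subn0.
Qed.

(** * From a checked table to a net over the complex numbers *)

Section TableNet.
Variables (C : numClosedFieldType) (M : seq (seq nat)).
Variables (T : seq (seq (Z * Z * Z))) (s : nat).
Hypothesis T_ok : ztable_ok M T s.

Definition zC : Z -> C := intr \o int_of_Z.

(** Characteristic zero carries the integer tests over to [C]. *)
Lemma zC_eq0 z : (zC z == 0) = (z == 0).
Proof. by rewrite /zC /= intr_eq0 -(rmorph0 int_of_Z) (can_eq int_of_ZK). Qed.

Definition zindex (x : netI) : nat * nat := (x.1 : nat, x.2 : nat).

Definition zline (x : netI) : 'rV[C]_3 :=
  let v := zentry T (zindex x) in
  \row_i nth 0 [:: zC v.1.1; zC v.1.2; zC v.2] i.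

Lemma zline_det x y z :
  (det3 (zline x) (zline y) (zline z) == 0) = zconc T (zindex x) (zindex y) (zindex z).
Proof.
rewrite /zconc -zC_eq0; congr (_ == 0); rewrite /zdet /det3 /dot !crossE !mxE /=.
by rewrite /zC /= !(rmorphD, rmorphN, rmorphM).
Qed.

Lemma mem_zindices x : zindex x \in zindices.
Proof. by apply: allpairs_f; rewrite mem_iota ltn_ord. Qed.

Lemma mem_zpairs x y :
  (zindex x, zindex y) \in [seq (u, v) | u <- zindices, v <- zindices].
Proof. by apply: allpairs_f; apply: mem_zindices. Qed.

Lemma zindex_inj : injective zindex.
Proof. by move=> [i a] [j b] [/val_inj-> /val_inj->]. Qed.

Lemma zindex_neq x y : x != y -> zindex x != zindex y.
Proof. exact: contra_neq (@zindex_inj x y). Qed.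

Lemma zline_arr : is_arrangement zline.
Proof.
have nz x y : x != y -> cross (zline x) (zline y) != 0.
  move=> xy; have /and4P[/allP/(_ _ (mem_zpairs x y)) + _ _ _] := T_ok.
  move=> /implyP/(_ (zindex_neq xy))/andP[/hasP[_ /allpairsP[kb [ki ba ->]] +] _].
  rewrite !mem_iota in ki ba.
  rewrite -(zline_det x y (Ordinal ki, Ordinal ba)); apply: contraNneq => xy0.
  by rewrite /det3 xy0 /dot !mxE !mul0r !addr0.
split=> [x|x y xy c].
  have : (0 < #|[set~ x]|)%N by rewrite cardsC1 card_prod !card_ord.
  case/card_gt0P => y; rewrite !inE eq_sym => /nz; apply: contraNneq => ->.
  by apply/eqP/rowP => i; rewrite !mxE !mul0r subrr.
apply: contraNneq (nz x y xy) => ->.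
by apply/eqP/rowP => i; rewrite !mxE; ring.
Qed.

Lemma zline_incid p x y z : p != 0 -> x != y -> incid p (zline x) -> incid p (zline y) ->
  incid p (zline z) = zconc T (zindex x) (zindex y) (zindex z).
Proof.
by move=> nz /(meet_neq0 zline_arr) xy px py; rewrite (incid_meet _ nz xy px py) zline_det.
Qed.

Lemma zline_net : is_net zline.
Proof.
move=> x y xy p nz px py k; have xy' : x != y by apply: contraNneq xy => ->.
have /and4P[_ /allP/(_ _ (mem_zpairs x y)) + _ _] := T_ok.
move=> /implyP/(_ xy)/all_iotaP/(_ k)/eqP; apply: etrans; rewrite -card_iota.
by apply: eq_card => a; rewrite !inE (zline_incid _ nz xy' px py).
Qed.

Lemma zline_mult : double_or_triple zline.
Proof.
move=> p nz /card_gt1P[x [y]]; rewrite !inE => -[px py xy].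
have /and4P[/allP/(_ _ (mem_zpairs x y)) + _ _ _] := T_ok.
move=> /implyP/(_ (zindex_neq xy))/andP[_]; apply: leq_trans.
(* The lines through [p] are counted class by class, to match the sum in the table test. *)
rewrite -sum1_card sumnE big_map -[iota 0 3]/(index_iota 0 3) big_mkord.
have -> : (\sum_(z in lines_through zline p) 1
    = \sum_(i < 3) \sum_(a < 4 | (i, a) \in lines_through zline p) 1)%N.
  by rewrite pair_big_dep /=; apply: eq_bigl => -[].
apply: leq_sum => i _; rewrite -card_iota -sum1_card leq_eqVlt; apply/orP; left.
apply/eqP/eq_bigl => a.
by rewrite !inE (zline_incid _ nz xy px py).
Qed.

Lemma zline_square : in_main_class zline M.
Proof.
(* The tables list their lines in the order of [M], so no relabelling occurs. *)
exists 1%g, (fun=> 1%g) => t; rewrite (net_tripleE zline t) /ls_triple !perm1.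
have /and4P[_ _ /allP/(_ _ (mem_zpairs (0, t 0) (0, t 1))) + _] := T_ok.
move=> /all_iotaP/(_ (t 2%:R))/eqP tM.
have detE := zline_det (0, t 0) (1, t 1) (2%:R, t 2%:R).
split=> [conc|sq].
  apply/eqP; apply: etrans (esym tM) _; apply: etrans (esym detE) _; apply/eqP.
  by apply: (concurrent_det3 zline_arr conc); rewrite ?inE.
apply/net_tripleE/det3_concurrent => //; first exact: zline_arr.
by apply/eqP; apply: etrans detE _; apply: etrans tM _; apply/eqP.
Qed.

Lemma zspecialP (j : 'I_3) (a : 'I_4) :
  zspecial T j a <-> concurrent zline (special j a).
Proof.
have [b [c [d [bc aE rE]]]] : exists b c d : 'I_4,
    [/\ b != c, forall x, (x != a) = (x \in [:: b; c; d])
      & rem (a : nat) (iota 0 4) = [:: b : nat; c : nat; d : nat]].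
  move: a; apply: ord4_ind.
  - by exists (inZp 1), (inZp 2), (inZp 3); split=> //; apply: ord4_ind.
  - by exists (inZp 0), (inZp 2), (inZp 3); split=> //; apply: ord4_ind.
  - by exists (inZp 0), (inZp 1), (inZp 3); split=> //; apply: ord4_ind.
  - by exists (inZp 0), (inZp 1), (inZp 2); split=> //; apply: ord4_ind.
rewrite /zspecial rE /= -(zline_det (j, b) (j, c) (j, d)).
have jbc : (j, b) != (j, c) by rewrite xpair_eqE eqxx.
split=> [/eqP/(det3_concurrent zline_arr jbc)|conc].
  apply: concurrentS; apply/subsetP => -[i x]; rewrite !inE /= => /andP[/eqP-> ].
  by rewrite aE !xpair_eqE !inE eqxx /= orbA.
by apply/eqP; apply: (concurrent_det3 zline_arr conc); rewrite ?inE ?eqxx ?aE ?inE ?eqxx ?orbT.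
Qed.

Lemma zline_types : #|types_i zline| = s.
Proof.
have /and4P[_ _ _ /eqP <-] := T_ok; rewrite -card_iota; apply: eq_card => j.
rewrite inE; apply/imsetP/hasP => [[[k a] /(marksP zline_arr) ka ->]|[a + ja]].
  exists (a : nat); first by rewrite mem_iota ltn_ord.
  exact/zspecialP.
rewrite mem_iota => a4; exists (j, Ordinal a4) => //; apply/(marksP zline_arr).
exact/(zspecialP j (Ordinal a4)).
Qed.

End TableNet.

Lemma realization (C : numClosedFieldType) M (s : 'I_3) : M = M1 \/ M = M2 ->
  exists L : netI -> 'rV[C]_3, good_net L M /\ situation L s.
Proof.
move=> MM; have [T T_ok] : exists T, ztable_ok M T (num_types s).
  case: MM => ->; move: s; apply: ord3_ind.
  - by exists table1_1; apply: ztable1_1_ok.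
  - by exists table1_2; apply: ztable1_2_ok.
  - by exists table1_3; apply: ztable1_3_ok.
  - by exists table2_1; apply: ztable2_1_ok.
  - by exists table2_2; apply: ztable2_2_ok.
  - by exists table2_3; apply: ztable2_3_ok.
exists (zline C T); split; last first.
  by apply: (situation_of_num_types (zline_arr C T_ok)); apply: zline_types T_ok.
by split; [apply: zline_arr T_ok|apply: zline_net T_ok
            |apply: zline_mult T_ok|apply: zline_square T_ok].
Qed.

Theorem theorem2p5 (C : numClosedFieldType) :
  (* classification *)
  (forall (M : seq (seq nat)) (L : netI -> 'rV[C]_3),
     (M = M1 \/ M = M2) -> good_net L M ->
     (situation1 L /\ num_triple_points L 16) \/
     (situation2 L /\ num_triple_points L 19) \/
     (situation3 L /\ num_triple_points L 17)) /\
  (* in particular, never exactly two classes of type (i) *)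
  (forall (M : seq (seq nat)) (L : netI -> 'rV[C]_3),
     (M = M1 \/ M = M2) -> good_net L M ->
     ~ (exists j, ~ type_i L j /\ forall j', j' != j -> type_i L j')) /\
  (* realizability of each situation for each main class *)
  (forall (M : seq (seq nat)) (s : 'I_3), (M = M1 \/ M = M2) ->
     exists L : netI -> 'rV[C]_3, good_net L M /\ situation L s) /\
  (* uniqueness up to lattice isomorphism within a situation *)
  (forall (M : seq (seq nat)) (s : 'I_3) (L L' : netI -> 'rV[C]_3),
     (M = M1 \/ M = M2) -> good_net L M -> good_net L' M ->
     situation L s -> situation L' s -> lattice_iso L L') /\
  (* hence the number of triple points determines A up to lattice iso *)
  (forall (M : seq (seq nat)) (n : nat) (L L' : netI -> 'rV[C]_3),
     (M = M1 \/ M = M2) -> good_net L M -> good_net L' M ->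
     num_triple_points L n -> num_triple_points L' n -> lattice_iso L L').
Proof.
have card_num (L : netI -> 'rV[C]_3) M n : good_net L M ->
    num_triple_points L n <-> n = (16 + #|types_i L|)%N.
  move=> [L_arr L_net L_mult _]; rewrite -card_triple_points //.
  exact: triple_points_num.
have class M (L : netI -> 'rV[C]_3) : (M = M1 \/ M = M2) -> good_net L M ->
    exists s, [/\ situation L s, #|types_i L| = num_types s
      & num_triple_points L (16 + num_types s)].
  move=> MM LM; have [s sE] := card_types_good MM LM; have [L_arr _ _ _] := LM.
  exists s; split; [exact: situation_of_num_types| by [] |].
  by apply/(card_num _ _ _ LM); rewrite sE.
split; [|split; [|split; [|split]]].
- move=> M L MM LM; have [s [sit _ num]] := class M L MM LM.
  move: s sit num; apply: ord3_ind => sit num; first by left.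
    by right; left.
  by right; right.
- move=> M L MM LM [j [nj jj]]; have [L_arr _ _ _] := LM.
  (* Exactly two classes would be of type (i), but the count is always 0, 3 or 1. *)
  have TE : types_i L = [set~ j].
    apply/setP => i; rewrite !inE; apply/idP/idP => [/(types_iP L_arr) ti|
      /jj/(types_iP L_arr)//].
    by apply/eqP => ij; apply: nj; rewrite -ij.
  have [s] := card_types_good MM LM; rewrite TE cardsC1 card_ord.
  by move: s; apply: ord3_ind.
- by move=> M s MM; apply: realization.
- move=> M s L L' MM LM L'M sit sit'; apply: (iso_good MM LM L'M).
  have [L_arr _ _ _] := LM; have [L'_arr _ _ _] := L'M.
  by rewrite (situationP L_arr sit) (situationP L'_arr sit').
move=> M n L L' MM LM L'M /(card_num _ _ _ LM) -> /(card_num _ _ _ L'M) /addnI same.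
exact: (iso_good MM LM L'M).
Qed.
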